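(* Let $v\in L(X)$ be real valued with $v(x)\ge0$ for all $x\in X$ and $v(x)>0$ for some $x\in X$. Let $f \in L(X^o)$ and $g \in L(\partial X)$. The unique solution $u\in L(X)$ of the problem $$\Delta u - v\cdot u = f \ \text{ on } X^o \quad\text{and}\quad u=g\ \text{ on } \partial X$$ is given on $X^o$ by $$u|_{X^o} = -\widetilde G_{X^o} \bigl( \tilde f - \widetilde P_{X^o, \partial X}\,g\bigr),$$ where $\tilde f(x)=\dfrac{f(x)}{1+v(x)}$ for $x\in X^o$, $\widetilde P=(\tilde p(x,y))_{x,y\in X}$ with $\tilde p(x,y)=\dfrac{p(x,y)}{1+v(x)}$, and $\widetilde G_{X^o}=(I_{X^o}-\widetilde P_{X^o})^{-1}=\sum_{n\ge0}\widetilde P_{X^o}^{\,n}$.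
   Context: Let $(X,E)$ be a finite directed graph with $|X|\ge 2$, $E\subset X^2$ without loops, which is strongly connected. Each edge $(x,y)\in E$ carries a weight $a(x,y)>0$, and $a(x,y)=0$ if $(x,y)\notin E$. Put $m(x)=\sum_y a(x,y)$, $p(x,y)=a(x,y)/m(x)$, $P=(p(x,y))_{x,y\in X}$. $L(B)$ is the space of functions $B\to\mathbb{C}$ (column vectors), $Pu(x)=\sum_y p(x,y)u(y)$, and $\Delta=P-I$. The boundary $\partial X$ is an arbitrary non-empty subset of $X$, and $X^o=X\setminus\partial X$. For a matrix $M$ over $X$ and $A,B\subset X$, $M_{A,B}$ is its restriction to $A\times B$, and $M_A=M_{A,A}$. *)

(* Defs.v *)
From HB Require Import structures.
From mathcomp Require Import all_boot all_order all_algebra.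
From mathcomp Require Import all_classical all_reals all_analysis.
From mathcomp Require Import complex.

Set Implicit Arguments.
Unset Strict Implicit.
Unset Printing Implicit Defensive.

Import Order.TTheory GRing.Theory Num.Theory.
Import numFieldNormedType.Exports.

Local Open Scope ring_scope.
Local Open Scope complex_scope.

(* R[i] gets the topology given by the modulus; matrices over R[i] then carry
   the topology of entrywise convergence. *)
HB.instance Definition _ (R : realType) := PseudoPointedMetric.copy R[i] R[i]^o.

(* L(X) is {ffun X -> R[i]}. For B : {set X}, L(B) is 'cV[R[i]]_#|B|, and
   matrices over A x B are 'M[R[i]]_(#|A|, #|B|): the index i : 'I_#|B| stands
   for the point enum_val i of B. *)

Section Network.
Variables (R : realType) (X : finType) (a : X -> X -> R).

Definition mass (x : X) : R := \sum_y a x y.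

Definition trans (x y : X) : R := a x y / mass x.

Definition trans_op (u : {ffun X -> R[i]}) : {ffun X -> R[i]} :=
  [ffun x => \sum_y (trans x y)%:C * u y].

Definition laplacian (u : {ffun X -> R[i]}) : {ffun X -> R[i]} :=
  trans_op u - u.

Definition trans_tilde (v : X -> R) (x y : X) : R := trans x y / (1 + v x).

End Network.

Section Restriction.
Variables (R : realType) (X : finType).

Definition inner_set (bX : {set X}) : {set X} := ~: bX.

Definition restr_fun (B : {set X}) (u : {ffun X -> R[i]}) : 'cV[R[i]]_#|B| :=
  \col_i u (enum_val i).

Definition restr_mx (A B : {set X}) (M : X -> X -> R) : 'M[R[i]]_(#|A|, #|B|) :=
  \matrix_(i, j) (M (enum_val i) (enum_val j))%:C.

Definition fun_tilde (B : {set X}) (v : X -> R) (f : 'cV[R[i]]_#|B|) :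
    'cV[R[i]]_#|B| :=
  \col_i (f i 0 / (1 + v (enum_val i))%:C).

Definition boundary_problem (a : X -> X -> R) (v : X -> R) (bX : {set X})
    (f : 'cV[R[i]]_#|inner_set bX|) (g : 'cV[R[i]]_#|bX|)
    (u : {ffun X -> R[i]}) : Prop :=
  restr_fun (inner_set bX) (laplacian a u - [ffun x => (v x)%:C * u x]) = f /\
  restr_fun bX u = g.

End Restriction.

(* Main.v *)
Require Import Defs.
From mathcomp Require Import all_boot all_order all_algebra.
From mathcomp Require Import all_classical all_reals all_analysis.
From mathcomp Require Import complex ring.

Import Order.TTheory GRing.Theory Num.Theory.
Import numFieldNormedType.Exports.

Local Open Scope classical_set_scope.
Local Open Scope ring_scope.

(** Dividing the equation on the interior by 1 + v turns the boundary value
    problem into the linear system (I - Pt) u = Ptb g - f / (1 + v) for the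
    interior values of u ([boundary_problemE]); its solution is the announced
    formula as soon as I - Pt is invertible. Since a function on X is the same
    as a pair of functions on the interior and on the boundary
    ([restr_fun_inj], [restr_fun_glue]), existence and uniqueness follow at once.

    Invertibility is a maximum principle ([maximum_principle]). If z vanishes on
    the boundary and z = Pt z inside, then at an interior point where |z| is
    maximal, |z| is at most a P-average of values that are no larger, so every
    successor of that point is again a maximum point. Strong connectedness
    gives a path from there to the non-empty boundary, where z = 0, so the
    maximum is 0.

    The Neumann series converges because the powers of Pt tend to 0
    ([cvg_expmx0]). Pt is nonnegative with row sums at most 1, hence the vectors
    Pt^k 1 of row sums are nonnegative and decrease with k. They have a limit w,
    and w = Pt w forces w = 0 by the invertibility already proved. Being
    nonnegative, the entries of Pt^k are dominated by the row sums, and the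
    telescoping identity ([neumann_partial]) concludes. All estimates are made
    for a real matrix, which is then embedded entrywise into the complex
    matrices. *)

(** * Convergence of matrices and of complex sequences *)

Lemma cvg_mx_entries (T : topologicalType) (m n : nat) (F : nat -> 'M[T]_(m, n))
    (M : 'M[T]_(m, n)) :
  (forall i j, (fun k => F k i j) @ \oo --> M i j) -> F @ \oo --> M.
Proof.
move=> FM A [P MP sPA].
suff H : \forall k \near \oo, forall i j, P i j (F k i j).
  by apply: filterS H => k; exact: sPA.
by apply: filter_forall => i; apply: filter_forall => j; exact: FM (MP i j).
Qed.

Lemma cvg_real_complex (R : realType) (u : nat -> R) (l : R) :
  u @ \oo --> l -> (fun k => (u k)%:C%C) @ \oo --> l%:C%C.
Proof.
move=> /cvgrPdist_lt ul; apply/(@cvgrPdist_lt R[i] R[i]^o) => -[e e'].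
rewrite ltcE /= => /andP[/eqP -> e0].
have := ul e e0; apply: filterS => k.
by rewrite -rmorphB normc_def /= expr0n addr0 sqrtr_sqr ltcR.
Qed.

(** * The Neumann series of a substochastic matrix *)

Section Substochastic.
Variables (R : realType) (n : nat) (Q : 'M[R]_n).
Hypothesis Q_ge0 : forall i j, 0 <= Q i j.
Hypothesis Q_le1 : forall i, \sum_j Q i j <= 1.
Hypothesis Q_unit : 1%:M - Q \in unitmx.

Definition rowsum (k : nat) (i : 'I_n) : R := \sum_j (Q ^+ k) i j.

Lemma expmx_ge0 k i j : 0 <= (Q ^+ k) i j.
Proof.
elim: k i j => [|k IHk] i j; first by rewrite expr0 mxE; case: eqP.
by rewrite exprS mxE sumr_ge0 // => l _; rewrite mulr_ge0.
Qed.

Lemma rowsumS k i : rowsum k.+1 i = \sum_l Q i l * rowsum k l.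
Proof.
rewrite /rowsum; under eq_bigr do rewrite exprS mxE.
by rewrite exchange_big; apply: eq_bigr => l _; rewrite mulr_sumr.
Qed.

Lemma rowsum_decr k i : rowsum k.+1 i <= rowsum k i.
Proof.
elim: k i => [|k IHk] i.
  rewrite {1}/rowsum expr1 (le_trans (Q_le1 i)) // /rowsum expr0.
  rewrite (bigD1 i) //= mxE eqxx big1 ?addr0 // => j.
  by rewrite mxE eq_sym => /negbTE->.
by rewrite rowsumS (rowsumS k) ler_sum // => l _; rewrite ler_wpM2l.
Qed.

(** The row sums decrease to a fixed vector of Q, and the invertibility of
    I - Q leaves only the zero vector. This replaces any estimate of the
    spectral radius. *)
Lemma cvg_rowsum i : (fun k => rowsum k i) @ \oo --> (0 : R).
Proof.
have cvg_w j : cvgn (fun k => rowsum k j).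
  apply: nonincreasing_is_cvgn.
    by apply/nonincreasing_seqP => k; exact: rowsum_decr.
  by exists 0 => _ [k _ <-]; rewrite sumr_ge0 // => l _; exact: expmx_ge0.
pose w : 'cV[R]_n := \col_j limn (fun k => rowsum k j).
have Qw : (1%:M - Q) *m w = 0.
  apply/eqP; rewrite mulmxBl mul1mx subr_eq0; apply/eqP/colP => j.
  rewrite !mxE; apply: cvg_lim => //.
  rewrite -(cvg_shiftS (fun k => rowsum k j)) /=.
  under eq_fun do rewrite rowsumS.
  apply: (cvg_big add_continuous) => l _.
  by rewrite !mxE; apply: cvgM (cvg_cst _) _; exact: cvg_w.
have w0 : w = 0 by rewrite -[w](mulKmx Q_unit) Qw mulmx0.
have /colP/(_ i) := w0; rewrite !mxE => <-; exact: cvg_w.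
Qed.

Lemma cvg_expmx0 i j : (fun k => (Q ^+ k) i j) @ \oo --> (0 : R).
Proof.
apply: (squeeze_cvgr _ (cvg_cst 0) (cvg_rowsum i)); apply: nearW => k.
rewrite expmx_ge0 /= /rowsum (bigD1 j) //= lerDl sumr_ge0 // => l _.
exact: expmx_ge0.
Qed.

Lemma neumann_partial k :
  series (fun m => Q ^+ m) k = invmx (1%:M - Q) - invmx (1%:M - Q) *m Q ^+ k.
Proof.
apply: (can_inj (mulKmx Q_unit)); rewrite mulmxBr mulmxV // mulKVmx //.
rewrite /series /= big_mkord.
by have := subrX1 Q k; rewrite -[1]/1%:M -(opprB 1%:M Q) mulNr => /(congr1 -%R);
  rewrite opprK opprB => ->.
Qed.

Lemma cvg_neumann i j :
  (fun k => series (fun m => Q ^+ m) k i j) @ \oo --> invmx (1%:M - Q) i j.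
Proof.
have GQ0 : (fun k => (invmx (1%:M - Q) *m Q ^+ k) i j) @ \oo -->
    \sum_l invmx (1%:M - Q) i l * 0.
  under eq_fun do rewrite mxE.
  apply: (cvg_big add_continuous) => l _.
  by apply: cvgM (cvg_cst _) _; exact: cvg_expmx0.
have {GQ0} := cvgB (cvg_cst (invmx (1%:M - Q) i j)) GQ0.
rewrite big1 ?subr0 => [cvgG|l _]; last by rewrite mulr0.
have seriesE k : series (fun m => Q ^+ m) k i j =
    invmx (1%:M - Q) i j - (invmx (1%:M - Q) *m Q ^+ k) i j.
  by rewrite neumann_partial 2!mxE.
by rewrite (funext seriesE); exact: cvgG.
Qed.

End Substochastic.

(** * Extension by zero *)

Section Extension.
Variables (K : pzSemiRingType) (X : finType) (A : {set X}).

(** The sum has exactly one term when x lies in A and none otherwise; this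
    avoids choosing a default index, which need not exist when A is empty. *)
Definition ext0 (c : 'cV[K]_#|A|) (x : X) : K := \sum_(i | enum_val i == x) c i 0.

Lemma ext0_val c i : ext0 c (enum_val i) = c i 0.
Proof.
rewrite /ext0 (big_pred1 i) // => j /=.
by apply/eqP/eqP => [/enum_val_inj|->].
Qed.

Lemma ext0_out c x : x \notin A -> ext0 c x = 0.
Proof.
move=> xA; rewrite /ext0 big1 // => i /eqP ix.
by rewrite -ix enum_valP in xA.
Qed.

Lemma sum_ext0 (M : X -> K) c :
  \sum_y M y * ext0 c y = \sum_j M (enum_val j) * c j 0.
Proof.
rewrite (bigID [in A]) /= [X in _ + X]big1 ?addr0; last first.
  by move=> y yA; rewrite ext0_out // mulr0.
by rewrite big_enum_val; apply: eq_bigr => j _; rewrite ext0_val.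
Qed.

End Extension.

Arguments ext0 {K X A} c x.
Arguments ext0_val {K X A} c i.
Arguments ext0_out {K X A} c {x}.

(** * The damped transition matrix *)

Section Network.
Variables (R : realType) (X : finType) (E : rel X) (a : X -> X -> R).
Variables (bX : {set X}) (v : X -> R).
Hypothesis hconn : forall x y : X, connect E x y.
Hypothesis ha_pos : forall x y : X, E x y -> 0 < a x y.
Hypothesis ha_zero : forall x y : X, ~~ E x y -> a x y = 0.
Hypothesis hbX : bX != finset.set0.
Hypothesis hv_ge0 : forall x : X, 0 <= v x.

Local Notation Xo := (inner_set bX).
Local Notation pt := (trans_tilde a v).

(** The damped transition matrix before its embedding into complex matrices. *)
Definition real_Pt : 'M[R]_#|Xo| :=
  \matrix_(i, j) pt (enum_val i) (enum_val j).

Lemma weight_ge0 x y : 0 <= a x y.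
Proof. by case: (boolP (E x y)) => [/ha_pos/ltW|/ha_zero->]. Qed.

Lemma mass_ge0 x : 0 <= mass a x.
Proof. by rewrite sumr_ge0 // => y _; exact: weight_ge0. Qed.

Lemma damping_ge1 x : 1 <= 1 + v x.
Proof. by rewrite lerDl. Qed.

Lemma damping_gt0 x : 0 < 1 + v x.
Proof. exact: lt_le_trans ltr01 (damping_ge1 x). Qed.

Lemma trans_ge0 x y : 0 <= trans a x y.
Proof. by rewrite divr_ge0 ?weight_ge0 ?mass_ge0. Qed.

(** The bound also covers points of mass 0, where the convention 1 / 0 = 0 makes
    the transition weights vanish. *)
Lemma trans_sum_le1 x : \sum_y trans a x y <= 1.
Proof.
by rewrite -mulr_suml; have [->|m0] := eqVneq (mass a x) 0;
  rewrite ?invr0 ?mulr0 // divff.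
Qed.

Lemma trans_tilde_ge0 x y : 0 <= pt x y.
Proof. by rewrite divr_ge0 ?trans_ge0 // ltW // damping_gt0. Qed.

Lemma trans_tilde_le x y : pt x y <= trans a x y.
Proof.
by rewrite ler_pdivrMr ?damping_gt0 // ler_peMr ?trans_ge0 ?damping_ge1.
Qed.

Lemma trans_gt0 x y : E x y -> 0 < trans a x y.
Proof.
move=> Exy; rewrite divr_gt0 ?ha_pos // /mass (bigD1 y) //=.
by rewrite ltr_wpDr ?ha_pos ?sumr_ge0 // => z _; exact: weight_ge0.
Qed.

Lemma real_Pt_sum_le1 i : \sum_j real_Pt i j <= 1.
Proof.
apply: le_trans (trans_sum_le1 (enum_val i)).
rewrite [leRHS](bigID [in Xo]) /= -[leLHS]addr0 lerD //.
  by rewrite [leRHS]big_enum_val; apply: ler_sum => j _; rewrite mxE trans_tilde_le.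
by rewrite sumr_ge0 // => y _; exact: trans_ge0.
Qed.

(** The absolute value of z is maximal at some point; maximality propagates
    along the edges out of interior points, hence reaches the boundary, where z
    is 0. *)
Lemma maximum_principle (z : X -> R) :
  {in bX, forall x, z x = 0} ->
  {in Xo, forall x, z x = \sum_y pt x y * z y} ->
  forall x, z x = 0.
Proof.
move=> z_bd z_int x0.
have [b bB] := finset.set0Pn _ hbX.
pose x1 := [arg max_(x > x0) `|z x|]%O.
have z_max y : `|z y| <= `|z x1|.
  by rewrite /x1; case: arg_maxP => // x _; exact.
suff zx1 : `|z x1| = 0.
  by apply/eqP; rewrite -normr_le0 -zx1.
(* If z were strictly smaller at one successor of x, the P-average would be
   strictly below the maximum, since that successor has positive weight. *)
have step x y : E x y -> x \notin bX -> `|z x| = `|z x1| -> `|z y| = `|z x1|.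
  move=> Exy xB zx; apply/eqP; rewrite eq_le z_max leNgt; apply/negP => zy.
  have : `|z x| < `|z x1|; last by rewrite zx ltxx.
  have xo : x \in Xo by rewrite inE.
  rewrite {1}z_int // (le_lt_trans (ler_norm_sum _ _ _)) //.
  apply: (@lt_le_trans _ _ (\sum_w trans a x w * `|z x1|)); last first.
    by rewrite -mulr_suml ler_piMl // trans_sum_le1.
  rewrite (bigD1 y) //= [ltRHS](bigD1 y) //= ltr_leD //.
    rewrite normrM ger0_norm ?trans_tilde_ge0 //.
    rewrite (le_lt_trans (ler_wpM2r _ (trans_tilde_le x y))) //.
    by rewrite ltr_pM2l ?trans_gt0.
  apply: ler_sum => w _.
  by rewrite normrM ger0_norm ?trans_tilde_ge0 // ler_pM ?trans_tilde_ge0 //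
    trans_tilde_le.
have [p x1p bE] := connectP (hconn x1 b).
have walk : forall p x, path E x p -> last x p \in bX -> `|z x| = `|z x1| ->
    `|z x1| = 0.
  elim=> [|y q IHq] x /=; first by move=> _ xB <-; rewrite z_bd ?normr0.
  move=> /andP[Exy yq] qB zx; have [xB|xB] := boolP (x \in bX).
    by rewrite -zx z_bd ?normr0.
  exact: IHq yq qB (step _ _ Exy xB zx).
by apply: walk x1p _ _; rewrite -?bE.
Qed.

(** A vector in the kernel, extended by zero to the boundary, satisfies the
    hypotheses of the maximum principle. *)
Lemma real_Pt_unit : 1%:M - real_Pt \in unitmx.
Proof.
(* Row freeness speaks of row vectors, so the column kernel of the matrix is
   reached through its transpose. *)
rewrite -unitmx_tr -row_free_unit; apply: inj_row_free => w wP.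
pose c : 'cV[R]_#|Xo| := w^T.
have cE : c = real_Pt *m c.
  by apply/eqP; rewrite -subr_eq0 -{1}[c]mul1mx -mulmxBl -trmx_eq0 trmx_mul
    trmxK wP.
have c0 x : ext0 c x = 0.
  apply: maximum_principle => y yX; first by rewrite ext0_out // inE yX.
  rewrite sum_ext0 -(enum_rankK_in yX yX) ext0_val {1}cE mxE.
  by apply: eq_bigr => j _; rewrite mxE.
by apply/rowP => i; rewrite mxE -(c0 (enum_val i)) ext0_val mxE.
Qed.

Local Notation Pt := (restr_mx Xo Xo pt).
Local Notation Ptb := (restr_mx Xo bX pt).

Lemma restr_mx_real : Pt = map_mx (real_complex R) real_Pt.
Proof. by apply/matrixP => i j; rewrite !mxE. Qed.

Lemma Pt_unit : 1%:M - Pt \in unitmx.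
Proof.
by rewrite restr_mx_real -(map_mx1 (real_complex R)) -map_mxB map_unitmx
  real_Pt_unit.
Qed.

Lemma cvg_Pt_series :
  series (fun n : nat => Pt ^+ n) @ \oo --> invmx (1%:M - Pt).
Proof.
have powE n : Pt ^+ n = map_mx (real_complex R) (real_Pt ^+ n).
  elim: n => [|n IHn]; first by rewrite !expr0 -[1]/1%:M map_mx1.
  by rewrite !exprS IHn -[_ * _]/(_ *m _) map_mxM -restr_mx_real.
apply: cvg_mx_entries => i j.
rewrite restr_mx_real -(map_mx1 (real_complex R)) -map_mxB -map_invmx mxE.
have seriesE k : series (fun n => map_mx (real_complex R) real_Pt ^+ n) k i j =
    (series (fun n => real_Pt ^+ n) k i j)%:C%C.
  rewrite /series /= !summxE rmorph_sum; apply: eq_bigr => m _.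
  by rewrite -restr_mx_real powE mxE.
rewrite (funext seriesE).
apply/cvg_real_complex/cvg_neumann; last exact: real_Pt_unit.
  by move=> k l; rewrite mxE trans_tilde_ge0.
exact: real_Pt_sum_le1.
Qed.

(** * The boundary value problem as a linear system *)

Lemma mulmx_restr (M : X -> X -> R) (u : {ffun X -> R[i]}) i :
  \sum_y (M (enum_val i) y)%:C%C * u y =
  (restr_mx Xo Xo M *m restr_fun Xo u) i 0 +
  (restr_mx Xo bX M *m restr_fun bX u) i 0.
Proof.
rewrite (bigID [in Xo]) /=; congr (_ + _); last first.
  rewrite (eq_bigl [in bX]) => [|y]; last by rewrite inE negbK.
  by rewrite [LHS]big_enum_val [RHS]mxE; apply: eq_bigr => j _; rewrite !mxE.
by rewrite [LHS]big_enum_val [RHS]mxE; apply: eq_bigr => j _; rewrite !mxE.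
Qed.

(** At an interior point, (P u - u) - v u is 1 + v times (Pt u + Ptb g - u), and
    1 + v never vanishes. *)
Lemma boundary_problemE f g (u : {ffun X -> R[i]}) :
  boundary_problem a v f g u <->
  (1%:M - Pt) *m restr_fun Xo u = Ptb *m g - fun_tilde v f /\
  restr_fun bX u = g.
Proof.
have kill0 x : (1 + v x)%:C%C != 0 :> R[i].
  by rewrite fmorph_eq0 gt_eqF ?damping_gt0.
have rowE i : (laplacian a u - [ffun x => (v x)%:C%C * u x]) (enum_val i) =
    (1 + v (enum_val i))%:C%C *
      ((Pt *m restr_fun Xo u) i 0 + (Ptb *m restr_fun bX u) i 0
       - u (enum_val i)).
  have diagE : (1 + v (enum_val i))%:C%C * u (enum_val i) =
      u (enum_val i) + (v (enum_val i))%:C%C * u (enum_val i).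
    by rewrite rmorphD rmorph1 mulrDl mul1r.
  rewrite -mulmx_restr !ffunE mulrBr mulr_sumr diagE opprD addrA.
  congr (_ - _ - _); apply: eq_bigr => y _.
  rewrite mulrA -(rmorphM (real_complex R)); congr (_%:C%C * _).
  by rewrite mulrCA divff ?mulr1 // gt_eqF ?damping_gt0.
have solveE (k A B U F : R[i]) : k != 0 ->
    k * (A + B - U) = F <-> U - A = B - F / k.
  move=> k0; split=> [<-|UA]; first by field.
  have -> : A + B - U = B - (U - A) by ring.
  by rewrite UA; field.
split=> -[eq_f eq_g]; split=> //; apply/colP => i; have /colP/(_ i) := eq_f.
  rewrite mxE rowE eq_g => /(solveE _ _ _ _ _ (kill0 _)).
  by rewrite mulmxBl mul1mx !mxE.
rewrite mulmxBl mul1mx => eq_i; rewrite mxE rowE eq_g.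
by apply/solveE; [exact: kill0 | move: eq_i; rewrite !mxE].
Qed.

Lemma restr_fun_inj (u w : {ffun X -> R[i]}) :
  restr_fun Xo u = restr_fun Xo w -> restr_fun bX u = restr_fun bX w -> u = w.
Proof.
move=> eqo eqb; apply/ffunP => x.
have restr_eq (A : {set X}) : restr_fun A u = restr_fun A w -> x \in A -> u x = w x.
  move=> /colP eqA xA; have := eqA (enum_rank_in xA x).
  by rewrite !mxE enum_rankK_in.
by have [xb|xb] := boolP (x \in bX); [apply: restr_eq eqb _|
  apply: restr_eq eqo _; rewrite inE].
Qed.

Lemma restr_fun_glue (c : 'cV[R[i]]_#|Xo|) (g : 'cV[R[i]]_#|bX|) :
  exists u : {ffun X -> R[i]}, restr_fun Xo u = c /\ restr_fun bX u = g.
Proof.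
exists [ffun x => ext0 c x + ext0 g x]; split; apply/colP => i; rewrite mxE ffunE.
  by rewrite ext0_val (ext0_out g) ?addr0 //; have := enum_valP i; rewrite inE.
by rewrite ext0_val ext0_out ?add0r // inE negbK enum_valP.
Qed.

End Network.

Theorem mainTheorem11 (R : realType) (X : finType) (E : rel X) (a : X -> X -> R)
    (bX : {set X}) (v : X -> R)
    (f : 'cV[R[i]]_#|inner_set bX|) (g : 'cV[R[i]]_#|bX|)
    (hX : (2 <= #|X|)%N)
    (hloop : irreflexive E)
    (hconn : forall x y : X, connect E x y)
    (ha_pos : forall x y : X, E x y -> 0 < a x y)
    (ha_zero : forall x y : X, ~~ E x y -> a x y = 0)
    (hbX : bX != finset.set0)
    (hv_ge0 : forall x : X, 0 <= v x)
    (hv_gt0 : exists x : X, 0 < v x) :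
  let Xo := inner_set bX in
  let Pt := restr_mx Xo Xo (trans_tilde a v) in
  let Ptb := restr_mx Xo bX (trans_tilde a v) in
  let Gt := invmx (1%:M - Pt) in
  [/\ 1%:M - Pt \in unitmx,
      series (fun n : nat => Pt ^+ n) @ \oo --> Gt,
      exists! u : {ffun X -> R[i]}, boundary_problem a v f g u &
      forall u : {ffun X -> R[i]}, boundary_problem a v f g u ->
        restr_fun Xo u = - (Gt *m (fun_tilde v f - Ptb *m g))].
Proof.
move=> Xo Pt Ptb Gt.
have unitP : 1%:M - Pt \in unitmx by exact: (Pt_unit _ _ E).
have solve u : boundary_problem a v f g u <->
    restr_fun Xo u = - (Gt *m (fun_tilde v f - Ptb *m g)) /\ restr_fun bX u = g.
  rewrite boundary_problemE // -mulmxN opprB -/Xo -/Pt -/Ptb.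
  split=> -[eq_u ->]; split=> //; first by rewrite -eq_u mulKmx.
  by rewrite eq_u mulKVmx.
split=> //; first exact: (cvg_Pt_series _ _ E).
  have [u [uo ub]] :=
    restr_fun_glue _ _ bX (- (Gt *m (fun_tilde v f - Ptb *m g))) g.
  exists u; split=> [|w /solve[wo wb]]; first exact/solve.
  by apply: (@restr_fun_inj _ _ bX); rewrite ?uo ?ub.
by move=> u /solve[].
Qed.
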